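(* Let $\mathrm{FIM}_X$ be the free inverse monoid generated by a finite set $X$ with $|X|\ge 2$. Then $\mathcal{R}\text{-}\mathrm{Geo}(\mathrm{FIM}_X)$ and $\mathcal{L}\text{-}\mathrm{Geo}(\mathrm{FIM}_X)$ are not co-context-free languages.
   Context: $\tilde X=X\cup X^{-1}$ with $X^{-1}=\{x^{-1}:x\in X\}$ a disjoint copy of $X$; $\pi:\tilde X^*\to \mathrm{FIM}_X$ is the canonical surjective homomorphism; $\ell(w)$ is the length of the word $w$. For $\mathcal{K}\in\{\mathcal{L},\mathcal{R}\}$ the corresponding Green's relation on $\mathrm{FIM}_X$, $$\mathcal{K}\text{-}\mathrm{Geo}(\mathrm{FIM}_X)=\bigl\{w\in\tilde X^*: \ell(w)=\min\{\ell(u): u\in\tilde X^*,\ (u\pi)\,\mathcal{K}\,(w\pi)\}\bigr\}.$$ A language $K\subseteq\tilde X^*$ is co-context-free if its complement $\tilde X^*\setminus K$ is context-free. *)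

(* Defs.v *)
From HB Require Import structures.
From Stdlib Require Import Relation_Operators.
From mathcomp Require Import all_boot.
From mathcomp Require Import boolp classical_sets.

Set Implicit Arguments.
Unset Strict Implicit.
Unset Printing Implicit Defensive.

Local Open Scope classical_set_scope.
Local Open Scope group_scope.
Local Open Scope quotient_scope.

Definition language (A : finType) := set (seq A).

(* In [inl n] / [inr a], n is a nonterminal and a is a terminal. *)
Record cfg (A : finType) := Cfg {
  nonterminal : finType;
  start : nonterminal;
  productions : seq (nonterminal * seq (nonterminal + A))
}.

Inductive cfg_step (A : finType) (G : cfg A) :
    seq (nonterminal G + A) -> seq (nonterminal G + A) -> Prop :=
  CfgStep p s n rhs of (n, rhs) \in productions G :
    cfg_step (p ++ inl n :: s) (p ++ rhs ++ s).

Definition cfg_language (A : finType) (G : cfg A) : language A :=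
  [set w | clos_refl_trans _ (@cfg_step A G)
             [:: inl (start G)] [seq inr a | a <- w]].

Definition context_free (A : finType) (L : language A) : Prop :=
  exists G : cfg A, L = cfg_language G.

Definition co_context_free (A : finType) (L : language A) : Prop :=
  context_free (~` L).

Section Green.
Variable M : monoidType.

Definition right_ideal (a : M) : set M := range (fun s => a * s).
Definition left_ideal (a : M) : set M := range (fun s => s * a).

Definition greenR (a b : M) : Prop := right_ideal a = right_ideal b.
Definition greenL (a b : M) : Prop := left_ideal a = left_ideal b.

End Green.

(* [inl x] is the letter x and [inr x] is its formal inverse. *)
Definition letter (X : finType) : finType := (X + X)%type.

Definition letter_inv (X : finType) (a : letter X) : letter X :=
  match a with inl x => inr x | inr x => inl x end.

Definition word_inv (X : finType) (w : seq (letter X)) : seq (letter X) :=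
  rev (map (@letter_inv X) w).

(* The congruence on words with involution generated by the relations
   u u^-1 u = u and u u^-1 v v^-1 = v v^-1 u u^-1 (Vagner's presentation
   of the free inverse monoid). *)
Inductive vagner (X : finType) : seq (letter X) -> seq (letter X) -> Prop :=
| vagner_reg u : vagner (u ++ word_inv u ++ u) u
| vagner_comm u v :
    vagner (u ++ word_inv u ++ v ++ word_inv v)
           (v ++ word_inv v ++ u ++ word_inv u)
| vagner_refl u : vagner u u
| vagner_sym u v of vagner u v : vagner v u
| vagner_trans u v w of vagner u v & vagner v w : vagner u w
| vagner_cat u u' v v' of vagner u u' & vagner v v' :
    vagner (u ++ v) (u' ++ v').

Section FreeInverseMonoid.
Variable X : finType.

Definition vagner_rel : rel (seq (letter X)) := fun u v => `[< vagner u v >].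

Lemma vagner_rel_equiv : equiv_class_of vagner_rel.
Proof.
split=> [u|u v|v u w]; first exact/asboolP/vagner_refl.
  by apply/asboolP/asboolP; apply: vagner_sym.
by move=> /asboolP uv /asboolP vw; apply/asboolP/(vagner_trans uv).
Qed.

Canonical vagner_equiv := EquivRelPack vagner_rel_equiv.

Definition FIM : Type := {eq_quot vagner_equiv}.
HB.instance Definition _ := Choice.on FIM.
HB.instance Definition _ := EqQuotient.on FIM.

Definition FIM_pi (w : seq (letter X)) : FIM := \pi_FIM w.

Lemma FIM_piP u v : FIM_pi u = FIM_pi v <-> vagner u v.
Proof.
split=> [/eqP|uv]; first by rewrite /FIM_pi piE => /asboolP.
by apply/eqP; rewrite /FIM_pi piE; apply/asboolP.
Qed.

Lemma FIM_pi_surj (a : FIM) : exists w, FIM_pi w = a.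
Proof. by exists (repr a); rewrite /FIM_pi reprK. Qed.

Definition FIM_one : FIM := FIM_pi [::].
Definition FIM_mul (a b : FIM) : FIM := FIM_pi (repr a ++ repr b).

Lemma FIM_mul_pi u v : FIM_mul (FIM_pi u) (FIM_pi v) = FIM_pi (u ++ v).
Proof. by apply/FIM_piP/vagner_cat; apply/FIM_piP; rewrite /FIM_pi reprK. Qed.

Lemma FIM_mulA : associative FIM_mul.
Proof.
move=> a b c.
have [u <-] := FIM_pi_surj a; have [v <-] := FIM_pi_surj b.
have [w <-] := FIM_pi_surj c.
by rewrite !FIM_mul_pi catA.
Qed.

Lemma FIM_mul1 : left_id FIM_one FIM_mul.
Proof. by move=> a; have [u <-] := FIM_pi_surj a; rewrite FIM_mul_pi. Qed.

Lemma FIM_mulr1 : right_id FIM_one FIM_mul.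
Proof. by move=> a; have [u <-] := FIM_pi_surj a; rewrite FIM_mul_pi cats0. Qed.

HB.instance Definition _ := isMonoid.Build FIM FIM_mulA FIM_mul1 FIM_mulr1.

Lemma FIM_piM u v : FIM_pi (u ++ v) = FIM_pi u * FIM_pi v.
Proof. exact: esym (FIM_mul_pi u v). Qed.

Lemma FIM_pi1 : FIM_pi [::] = 1.
Proof. reflexivity. Qed.

End FreeInverseMonoid.

Definition is_min (S : set nat) (n : nat) : Prop :=
  S n /\ forall m, S m -> n <= m.

(* [Geo K] is K-Geo(FIM_X), for K a relation on FIM_X. *)
Definition Geo (X : finType) (K : FIM X -> FIM X -> Prop) :
    language (letter X) :=
  [set w | is_min [set size u | u in [set u | K (FIM_pi u) (FIM_pi w)]]
                  (size w)].

(* Main.v *)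
Require Import Defs.
From Stdlib Require Import Relation_Operators Operators_Properties.
From mathcomp Require Import all_boot.
From mathcomp Require Import ssralg ssrint zify.
From mathcomp Require Import boolp classical_sets.

Set Implicit Arguments.
Unset Strict Implicit.
Unset Printing Implicit Defensive.

(** The R-class of an element of the free inverse monoid is determined by its
Munn tree, so a word is R-geodesic when no shorter walk from the root of the
Cayley tree of the free group covers the same subtree.  Fix two generators
with letters a, b and inverses a', b'.  The word
    [staircase K]  =  a^(K+1) a'^(K+1) b'^K
covers one branch of length K+1 and then one of length K, and ends at the tip
of the shorter one; running through the shorter branch first saves one letter,
so the word lies in the complement of the R-geodesics ([staircase_not_Geo]).

The margin is one letter, and every pumping loses it.  By the
pumping lemma ([context_free_pumpable], proved below for grammars with
arbitrary productions) a context-free complement would contain every word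
obtained by pumping two factors v, t lying in a window of length at most K.
 - If v and t avoid a, doubling them lengthens the part after a^(K+1): the walk
   now ends at distance at least K+1 from the root, and is geodesic
   ([staircase_pump_up]).
 - Otherwise the window is too short to reach b', and deleting v and t shortens
   the a-branch to length at most K, while the K letters b' keep the end point
   at distance at least K from the root, so the walk is geodesic again
   ([staircase_pump_down]).
Either way a geodesic word would lie in the complement.

That these walks are geodesic does not need the free group.  The set of points
visited by a walk and its end point are invariants of the element of the free
inverse monoid in any quotient group; here the Cayley graph of Z x Z with the
l1 metric is enough, because both legs of each walk are already geodesic there
([Geo_cat], [Geo_pos_neg]).

The statement for L follows by symmetry: inverting words exchanges R and L
([Geo_greenL]), and the conclusion of the pumping lemma is invariant under
inversion ([pumpable_word_inv]). *)

(** * The pumping lemma for context-free grammars *)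

Definition wpow (A : Type) (v : seq A) (i : nat) : seq A := flatten (nseq i v).

Definition pumps (A : finType) (L : seq A -> Prop) (K : nat) (w : seq A) :=
  exists u v x y z, [/\ w = u ++ v ++ x ++ y ++ z,
    0 < size (v ++ y), size (v ++ x ++ y) <= K &
    forall i, L (u ++ wpow v i ++ x ++ wpow y i ++ z)].

Definition pumpable (A : finType) (L : language A) :=
  exists K, forall w, L w -> K < size w -> pumps L K w.

Lemma wpowS (A : Type) (v : seq A) i : wpow v i.+1 = v ++ wpow v i.
Proof. by []. Qed.

Lemma wpowSr (A : Type) (v : seq A) i : wpow v i.+1 = wpow v i ++ v.
Proof.
elim: i => [|i IHi]; first by rewrite /wpow /= cats0.
by rewrite /wpow /= in IHi *; rewrite {1}IHi catA.
Qed.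

Section Pumping.
Variables (A : finType) (G : cfg A).

Local Notation symbol := (nonterminal G + A)%type.

(** Big-step form of derivation: each nonterminal of a sentential form is
expanded independently of its neighbours, so that one induction visits the
parse forest without trees having to be represented. *)
Inductive yields : seq symbol -> seq A -> Prop :=
| yields_nil : yields [::] [::]
| yields_terminal a s w of yields s w : yields (inr a :: s) (a :: w)
| yields_nonterminal n rhs s v w of (n, rhs) \in productions G &
    yields rhs v & yields s w : yields (inl n :: s) (v ++ w).

Lemma yields_cat s t v w : yields s v -> yields t w -> yields (s ++ t) (v ++ w).
Proof.
move=> sv tw; elim: sv => [|a s' v' _ IH|n rhs s' v1 v2 nP rv _ _ IH] //=.
  exact: yields_terminal.
by rewrite -catA; apply: (yields_nonterminal nP rv IH).
Qed.

Lemma yields_split s t w : yields (s ++ t) w ->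
  exists v1 v2, [/\ w = v1 ++ v2, yields s v1 & yields t v2].
Proof.
move Er: (s ++ t) => r H.
elim: H s Er => [|a r' w' rw IH|n rhs r' v w' nP rv _ rw IH].
- by case=> //= ->; exists [::], [::]; split=> //; exact: yields_nil.
- case=> [/= ->|c s /= [-> /IH[v1 [v2 [-> sv1 tv2]]]]].
    by exists [::], (a :: w'); split; [| exact: yields_nil | exact: yields_terminal].
  by exists (a :: v1), v2; split; [| exact: yields_terminal |].
- case=> [/= ->|c s /= [-> /IH[v1 [v2 [-> sv1 tv2]]]]].
    exists [::], (v ++ w'); split; [by [] | exact: yields_nil |].
    exact: yields_nonterminal nP rv rw.
  exists (v ++ v1), v2; rewrite catA; split; [by [] | | by []].
  exact: yields_nonterminal nP rv sv1.
Qed.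

Lemma yields_map_inr w : yields [seq inr a | a <- w] w.
Proof. by elim: w => [|a w IH] /=; [exact: yields_nil | exact: yields_terminal]. Qed.

Lemma yields_step s t w : cfg_step s t -> yields t w -> yields s w.
Proof.
case=> p q n rhs nP /yields_split[v1 [v2 [-> pv1]]].
move=> /yields_split[v3 [v4 [-> rv3 qv4]]].
exact: yields_cat pv1 (yields_nonterminal nP rv3 qv4).
Qed.

Local Notation derives := (clos_refl_trans _ (@cfg_step A G)).

Lemma derives_context p q s t : derives s t -> derives (p ++ s ++ q) (p ++ t ++ q).
Proof.
elim=> [s' t' [p' q' n rhs nP]|s'|s1 s2 s3 _ IH1 _ IH2].
- apply: rt_step; have := @CfgStep _ G (p ++ p') (q' ++ q) n rhs nP.
  by rewrite /= -!catA.
- exact: rt_refl.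
- exact: rt_trans IH1 IH2.
Qed.

Lemma yields_derives s w : yields s w -> derives s [seq inr a | a <- w].
Proof.
elim=> [|a s' w' _ IH|n rhs s' v w' nP _ IHv _ IHw]; first exact: rt_refl.
  by move: (derives_context [:: inr a] [::] IH); rewrite /= !cats0.
apply: rt_trans (rt_step _ _ _ _ (@CfgStep _ _ [::] s' n rhs nP)) _.
rewrite map_cat.
apply: rt_trans (derives_context [::] s' IHv) _.
by move: (derives_context [seq inr a | a <- v] [::] IHw); rewrite /= !cats0.
Qed.

Lemma cfg_languageE w : cfg_language G w <-> yields [:: inl (start G)] w.
Proof.
split=> [|/yields_derives //].
move=> /clos_rt_rt1n_iff.
move Ew: [seq inr a | a <- w] => t d; elim: d Ew => [s <-|s1 s2 s3 st _ IH Ew].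
  exact: yields_map_inr.
exact: yields_step st (IH Ew).
Qed.

(** Pumping a factor pumps the whole word, contexts being semantic: a context
of [s] in [t] is a pair of words that completes every word of [s]. *)
Lemma pumps_context s t K p q w :
  (forall x, yields s x -> yields t (p ++ x ++ q)) ->
  pumps (yields s) K w -> pumps (yields t) K (p ++ w ++ q).
Proof.
move=> st [u [v [x [y [z [-> vy K_ H]]]]]].
exists (p ++ u), v, x, y, (z ++ q); split=> // [|i]; first by rewrite -!catA.
by have := st _ (H i); rewrite -!catA.
Qed.

(** [n] labels a node of a parse of [w] from [s]; the node covers the part
between [u] and [z], and its subtree can be replaced by any other rooted at
[n]. *)
Definition occurs_in (s : seq symbol) (w : seq A) n u z :=
  exists x, [/\ w = u ++ x ++ z, yields [:: inl n] x &
    forall x', yields [:: inl n] x' -> yields s (u ++ x' ++ z)].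

Definition occurs s w n := exists u z, occurs_in s w n u z.
Definition occurs_strictly s w n :=
  exists u z, occurs_in s w n u z /\ 0 < size (u ++ z).

Lemma occurs_context s t p q w n u z :
  (forall x, yields s x -> yields t (p ++ x ++ q)) ->
  occurs_in s w n u z -> occurs_in t (p ++ w ++ q) n (p ++ u) (z ++ q).
Proof.
move=> st [x [-> nx H]]; exists x; split=> // [|x' nx']; first by rewrite -!catA.
by have := st _ (H _ nx'); rewrite -!catA.
Qed.

Definition rhs_bound := (\max_(p <- productions G) size p.2).+1.
Definition pump_bound := rhs_bound ^ #|nonterminal G|.+1.

Lemma rhs_boundP n rhs : (n, rhs) \in productions G -> size rhs <= rhs_bound.
Proof. by move=> nP; apply/ltnW; rewrite ltnS; apply: (leq_bigmax_seq (n, rhs)). Qed.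

(** A nonterminal below itself can be iterated; strictness of the occurrence
is what makes the two pumped factors not both empty, even in the presence of
unit and empty productions. *)
Lemma pumps_of_recursion n w : yields [:: inl n] w ->
  size w <= pump_bound -> occurs_strictly [:: inl n] w n ->
  pumps (yields [:: inl n]) pump_bound w.
Proof.
move=> nw wK [v [y [[x [Ew nx H]] vy]]].
exists [::], v, x, y, [::]; rewrite !cats0 /= -Ew; split=> //.
elim=> [|i IH]; first by rewrite /wpow /= cats0.
by rewrite cats0 in IH; have := H _ IH; rewrite cats0 wpowS wpowSr -!catA.
Qed.

(** The set [S] collects nonterminals on a path to a large subtree, one below
each branching node, that is, node with two children of nonempty yield.  Each
branching node multiplies the yield by at most [rhs_bound], and meeting a nonterminal
already in [S] is a recursion with a small yield, hence a pump.

The bounds come in two forms because they serve two purposes in the induction.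
The strict one is what a parent node consumes: a recursion must produce some
letter.  The other one, linear in the number of symbols of [s], adds up along
a right-hand side; it becomes strict as soon as two symbols have a nonempty
yield, any occurrence then having something beside it. *)
Lemma pumps_or_small s w : yields s w ->
  pumps (yields s) pump_bound w \/
  (exists S : {set nonterminal G},
     size w <= maxn (size s) rhs_bound * rhs_bound ^ #|S| /\
     {in S, forall n, occurs_strictly s w n}) /\
  (exists S : {set nonterminal G},
     size w <= size s * rhs_bound ^ #|S| /\ {in S, forall n, occurs s w n}).
Proof.
have M0 k : 0 < rhs_bound ^ k by rewrite expn_gt0.
elim=> {s w} [|a s w sw IH|n rhs s v w nP rv IHv sw IHw].
- by right; split; exists finset.set0; split=> // m; rewrite inE.
- have ctx x : yields s x -> yields (inr a :: s) ([:: a] ++ x ++ [::]).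
    by rewrite cats0; apply: yields_terminal.
  case: IH => [P|[_ [S [wS inS]]]].
    by left; have := pumps_context ctx P; rewrite cats0.
  have occ m : m \in S -> occurs_strictly (inr a :: s) (a :: w) m.
    move=> /inS[u [z]] /(occurs_context ctx); rewrite !cats0 => H.
    by exists ([:: a] ++ u), z.
  have bnd : size (a :: w) <= (size s).+1 * rhs_bound ^ #|S|.
    by rewrite mulSn /=; move: (M0 #|S|); lia.
  right; split; exists S; split=> //.
    by apply: leq_trans bnd _; rewrite leq_mul2r leq_maxl orbT.
  by move=> m /occ[u [z [H _]]]; exists u, z.
- have ctxn x : yields rhs x -> yields [:: inl n] x.
    by move=> rx; rewrite -[x]cats0; apply: yields_nonterminal nP rx yields_nil.
  have ctx1 x : yields [:: inl n] x -> yields (inl n :: s) ([::] ++ x ++ w).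
    by move=> nx; apply: (@yields_cat [:: _] s x w nx sw).
  have ctx2 x : yields s x -> yields (inl n :: s) (v ++ x ++ [::]).
    by move=> sx; rewrite cats0; apply: yields_nonterminal nP rv sx.
  have pump1 : pumps (yields [:: inl n]) pump_bound v ->
      pumps (yields (inl n :: s)) pump_bound (v ++ w) by exact: (pumps_context ctx1).
  case: IHv => [P|[[S1 [vS1 inS1]] _]].
    left; apply: pump1.
    rewrite -[v]cats0; apply: (@pumps_context rhs _ _ [::] [::]) P => x.
    by rewrite cats0; apply: ctxn.
  case: IHw => [P|[[S2 [wS2 inS2]] [S3 [wS3 inS3]]]].
    by left; have := pumps_context ctx2 P; rewrite cats0.
  have {}vS1 : size v <= rhs_bound ^ #|S1|.+1.
    by move: vS1; rewrite (maxn_idPr (rhs_boundP nP)) expnS.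
  have {}inS1 m : m \in S1 -> occurs_strictly [:: inl n] v m.
    move=> /inS1[u [z [H uz]]]; exists u, z; split=> //.
    rewrite -[v]cats0 -[z]cats0; apply: (@occurs_context rhs _ [::] [::]) H => x.
    by rewrite cats0; apply: ctxn.
  (* [n] occurs strictly below itself and its yield is bounded. *)
  case: (boolP (n \in S1)) => [nS1|nS1].
    left; apply: pump1; apply: pumps_of_recursion (ctxn _ rv) _ (inS1 _ nS1).
    by apply: leq_trans vS1 _; rewrite leq_pexp2l // ltnS max_card.
  pose occ m := exists u z, occurs_in (inl n :: s) (v ++ w) m u z /\
    (0 < size v -> 0 < size w -> 0 < size (u ++ z)).
  have occ1 m : m \in (n |: S1)%SET -> occ m.
    rewrite !inE => /orP[/eqP->|/inS1[u [z [/(occurs_context ctx1) H _]]]].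
      exists [::], w; split=> //; exists v; split=> //; exact: ctxn.
    by exists u, (z ++ w); split=> //; rewrite !size_cat; lia.
  have occ3 m : m \in S3 -> occ m.
    move=> /inS3[u [z /(occurs_context ctx2)]]; rewrite !cats0 => H.
    by exists (v ++ u), z; split=> //; rewrite !size_cat; lia.
  have [S [occS leS1 leS3]] : exists S : {set nonterminal G},
      [/\ {in S, forall m, occ m}, #|S1|.+1 <= #|S| & #|S3| <= #|S|].
    have c1 : #|(n |: S1)%SET| = #|S1|.+1 by rewrite cardsU1 nS1.
    case: (leqP #|S3| #|S1|.+1) => c3; last by exists S3; split=> //; apply: ltnW.
    by exists (n |: S1)%SET; rewrite c1.
  have bnd : size (v ++ w) <= (size s).+1 * rhs_bound ^ #|S|.
    rewrite size_cat mulSn leq_add //.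
      by apply: leq_trans vS1 _; rewrite leq_pexp2l.
    by apply: leq_trans wS3 _; rewrite leq_mul2l leq_pexp2l ?orbT.
  right; split; last first.
    by exists S; split=> // m /occS[u [z [H _]]]; exists u, z.
  (* When only one side has a nonempty yield, its strict bound is inherited. *)
  case: (posnP (size v)) => [v0|v_gt0].
    exists S2; split.
      rewrite size_cat v0; apply: leq_trans wS2 _.
      by rewrite leq_mul2r /= geq_max !leq_max leqnn leqnSn !orbT.
    move=> m /inS2[u [z [/(occurs_context ctx2)]]]; rewrite !cats0 => H uz.
    by exists (v ++ u), z; split=> //; move: uz; rewrite !size_cat; lia.
  case: (posnP (size w)) => [w0|w_gt0].
    exists S1; split.
      rewrite size_cat w0 addn0; apply: leq_trans vS1 _.
      by rewrite expnS leq_mul2r leq_maxr orbT.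
    move=> m /inS1[u [z [/(occurs_context ctx1) H uz]]].
    by exists u, (z ++ w); split=> //; move: uz; rewrite !size_cat; lia.
  exists S; split; first by apply: leq_trans bnd _; rewrite leq_mul2r leq_maxl orbT.
  by move=> m /occS[u [z [H uz]]]; exists u, z; split=> //; apply: uz.
Qed.

End Pumping.

(** In the absence of a pump, the strict bound limits the length of a word by
[pump_bound], since [S] has at most as many elements as there are
nonterminals. *)
Lemma context_free_pumpable (A : finType) (L : language A) :
  context_free L -> pumpable L.
Proof.
case=> G ->; exists (pump_bound G) => w /cfg_languageE Gw wK.
case: (pumps_or_small Gw) => [|[[S [wS _]] _]].
  case=> u [v [x [y [z [Ew vy K_ H]]]]]; exists u, v, x, y, z; split=> // i.
  exact/cfg_languageE.
suff: size w <= pump_bound G by rewrite leqNgt wK.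
apply: leq_trans wS _.
by rewrite (maxn_idPr _) // -expnS leq_pexp2l // ltnS max_card.
Qed.

(** * Green's relations on words, and the symmetry between L and R *)

Section Vagner.
Variable X : finType.
Implicit Types u v w : seq (letter X).

Lemma word_inv_cat u v : word_inv (u ++ v) = word_inv v ++ word_inv u.
Proof. by rewrite /word_inv map_cat rev_cat. Qed.

Lemma word_inv_cons c u : word_inv (c :: u) = word_inv u ++ [:: letter_inv c].
Proof. by rewrite (word_inv_cat [:: c]). Qed.

Lemma word_invK : involutive (@word_inv X).
Proof.
move=> u; rewrite /word_inv map_rev revK -map_comp -[RHS]map_id.
by apply: eq_map; case.
Qed.

Lemma size_word_inv u : size (word_inv u) = size u.
Proof. by rewrite size_rev size_map. Qed.

Lemma word_inv_wpow u i : word_inv (wpow u i) = wpow (word_inv u) i.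
Proof. by elim: i => // i IHi; rewrite wpowS wpowSr word_inv_cat IHi. Qed.

Lemma vagner_inv u v : vagner u v -> vagner (word_inv u) (word_inv v).
Proof.
elim=> {u v} [u|u v|u|u v _|u v w _ IH1 _ IH2|u u' v v' _ IH1 _ IH2].
- by rewrite !word_inv_cat -catA; apply: vagner_reg.
- rewrite !word_inv_cat -!catA.
  have := vagner_comm v u; by rewrite !word_invK.
- exact: vagner_refl.
- exact: vagner_sym.
- exact: vagner_trans IH1 IH2.
- by rewrite !word_inv_cat; apply: vagner_cat.
Qed.

(** Since the monoid has a unit, equality of the principal right ideals means
that each generator is a right multiple of the other. *)
Lemma greenR_vagner u v : greenR (FIM_pi u) (FIM_pi v) <->
  (exists s, vagner (u ++ s) v) /\ (exists t, vagner (v ++ t) u).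
Proof.
have sub u' v' : right_ideal (FIM_pi u') = right_ideal (FIM_pi v') ->
    exists t, vagner (v' ++ t) u'.
  move=> E; have : right_ideal (FIM_pi v') (FIM_pi u').
    by rewrite -E; exists (FIM_one X) => //; exact: FIM_mulr1.
  case=> s _; have [t <-] := FIM_pi_surj s.
  by rewrite -FIM_piM => /FIM_piP; exists t.
split=> [E|[[s us] [t vt]]]; first by split; apply: sub.
apply/seteqP; split=> _ [m _ <-].
  exists (FIM_mul (FIM_pi t) m) => //.
  by rewrite /= mulgA -FIM_piM; congr (_ * _)%g; apply/FIM_piP.
exists (FIM_mul (FIM_pi s) m) => //.
by rewrite /= mulgA -FIM_piM; congr (_ * _)%g; apply/FIM_piP.
Qed.

Lemma greenL_vagner u v : greenL (FIM_pi u) (FIM_pi v) <->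
  (exists s, vagner (s ++ u) v) /\ (exists t, vagner (t ++ v) u).
Proof.
have sub u' v' : left_ideal (FIM_pi u') = left_ideal (FIM_pi v') ->
    exists t, vagner (t ++ v') u'.
  move=> E; have : left_ideal (FIM_pi v') (FIM_pi u').
    by rewrite -E; exists (FIM_one X) => //; exact: FIM_mul1.
  case=> s _; have [t <-] := FIM_pi_surj s.
  by rewrite -FIM_piM => /FIM_piP; exists t.
split=> [E|[[s us] [t vt]]]; first by split; apply: sub.
apply/seteqP; split=> _ [m _ <-].
  exists (FIM_mul m (FIM_pi t)) => //.
  by rewrite /= -mulgA -FIM_piM; congr (_ * _)%g; apply/FIM_piP.
exists (FIM_mul m (FIM_pi s)) => //.
by rewrite /= -mulgA -FIM_piM; congr (_ * _)%g; apply/FIM_piP.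
Qed.

Lemma greenL_inv u v : greenL (FIM_pi u) (FIM_pi v) <->
  greenR (FIM_pi (word_inv u)) (FIM_pi (word_inv v)).
Proof.
rewrite greenL_vagner greenR_vagner.
split=> -[[s us] [t vt]]; split.
- by exists (word_inv s); rewrite -word_inv_cat; apply: vagner_inv.
- by exists (word_inv t); rewrite -word_inv_cat; apply: vagner_inv.
- exists (word_inv s); have := vagner_inv us.
  by rewrite word_inv_cat !word_invK.
- exists (word_inv t); have := vagner_inv vt.
  by rewrite word_inv_cat !word_invK.
Qed.

Lemma Geo_greenL w :
  Geo (@greenL (FIM X)) w <-> Geo (@greenR (FIM X)) (word_inv w).
Proof.
rewrite /Geo /= size_word_inv; set S := image _ _; set T := image _ _.
suff -> : S = T by [].
apply/seteqP; split=> _ [u uw <-].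
  by exists (word_inv u); [exact/greenL_inv | exact: size_word_inv].
exists (word_inv u); last exact: size_word_inv.
by apply/greenL_inv; rewrite word_invK.
Qed.

(** A factorisation read backwards is a factorisation of the same shape, the
two pumped factors being exchanged.  So the passage from L to R can take place
once grammars have been left behind. *)
Lemma pumpable_word_inv (L : language (letter X)) :
  pumpable L -> pumpable [set w | L (word_inv w)]%classic.
Proof.
case=> K pumpL; exists K => w Lw Kw.
have [|u [v [x [y [z [Ew vy K_ H]]]]]] := pumpL _ Lw; first by rewrite size_word_inv.
exists (word_inv z), (word_inv y), (word_inv x), (word_inv v), (word_inv u).
split.
- by rewrite -[w]word_invK Ew !word_inv_cat -!catA.
- by rewrite size_cat !size_word_inv addnC -size_cat.
- by move: K_; rewrite !size_cat !size_word_inv; lia.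
- move=> i; have := H i.
  by rewrite /= !word_inv_cat !word_inv_wpow !word_invK -!catA.
Qed.

End Vagner.

(** * Walks in an abelian quotient *)

Import GRing.Theory.

Section Trace.
Local Open Scope ring_scope.
Variables (X : finType) (V : zmodType) (phi : X -> V).
Implicit Types (u v w : seq (letter X)) (p q : V).

Definition step (c : letter X) : V :=
  match c with inl x => phi x | inr x => - phi x end.

(** The end point of the walk spelled by [w] from the origin of the Cayley
graph of [V] with respect to [phi]. *)
Definition place w : V := \sum_(c <- w) step c.

(** The points visited by that walk: the image in [V] of the Munn tree. *)
Fixpoint trace w p : Prop :=
  p = 0 \/ if w is c :: w' then trace w' (p - step c) else False.

Lemma place_cons c w : place (c :: w) = step c + place w.
Proof. exact: big_cons. Qed.

Lemma place_cat u v : place (u ++ v) = place u + place v.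
Proof. exact: big_cat. Qed.

Lemma place_inv w : place (word_inv w) = - place w.
Proof.
elim: w => [|c w IH]; first by rewrite /place !big_nil oppr0.
rewrite word_inv_cons place_cat IH (place_cons c) opprD addrC /place big_seq1.
by case: c => x //=; rewrite opprK.
Qed.

Lemma trace0 w : trace w 0.
Proof. by case: w => [|c w]; left. Qed.

Lemma trace_cat u v p : trace (u ++ v) p <-> trace u p \/ trace v (p - place u).
Proof.
elim: u p => [|c u IH] p /=.
  rewrite /place big_nil subr0; split; first by right.
  by case=> // -[] // ->; apply: trace0.
rewrite IH place_cons opprD addrA; tauto.
Qed.

Lemma trace_place w : trace w (place w).
Proof.
by rewrite -[w in trace w]cats0; apply/trace_cat; right; rewrite subrr; left.
Qed.

Lemma trace_inv w p : trace (word_inv w) p <-> trace w (p + place w).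
Proof.
elim: w p => [|c w IH] p; first by rewrite /place big_nil addr0.
have Ec : step (letter_inv c) = - step c by case: c => x //=; rewrite opprK.
rewrite word_inv_cons place_cons; split.
  move=> /trace_cat[/IH|].
    by right; rewrite [step c + _]addrC addrA addrK.
  rewrite place_inv opprK /= Ec opprK => -[E|[E|[]]].
    by right; rewrite [step c + _]addrC addrA addrK E; apply: trace0.
  by left; rewrite [step c + _]addrC addrA.
move=> /= [E|].
  apply/trace_cat; right=> /=; right; left.
  by rewrite place_inv opprK Ec opprK -E [step c + _]addrC addrA.
by rewrite [step c + _]addrC addrA addrK => /IH H; apply/trace_cat; left.
Qed.

Lemma vagner_place u v : vagner u v -> place u = place v.
Proof.
elim=> {u v} [u|u v|u|u v _|u v w _ IH1 _ IH2|u u' v v' _ IH1 _ IH2] //.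
- by rewrite !place_cat place_inv addNr addr0.
- by rewrite !place_cat !place_inv !addrA !addrK !subrr.
- by rewrite IH1.
- by rewrite !place_cat IH1 IH2.
Qed.

(** A walk followed by its reverse visits what the walk visits and comes back.
Hence u u^-1 u visits what u visits, and two closed walks from the same
point visit the same points in either order. *)
Lemma vagner_trace u v p : vagner u v -> trace u p <-> trace v p.
Proof.
move=> uv; elim: uv p => {u v}
  [u|u v|u|u v _ IH|u v w _ IH1 _ IH2|u u' v v' uu IH1 vv IH2] p.
- rewrite !trace_cat trace_inv place_inv opprK !subrK; tauto.
- rewrite !trace_cat !trace_inv !place_inv !opprK !subrK; tauto.
- by [].
- by rewrite IH.
- by rewrite IH1 IH2.
- by rewrite !trace_cat IH1 IH2 (vagner_place uu).
Qed.

(** A right multiple extends the walk, so R-equivalent words visit the same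
points. *)
Lemma greenR_trace u w p :
  greenR (FIM_pi u) (FIM_pi w) -> trace w p -> trace u p.
Proof.
move=> /greenR_vagner[_ [t wt]] wp.
by apply/(vagner_trace p wt)/trace_cat; left.
Qed.

Lemma trace_split w p : trace w p -> exists u v, w = u ++ v /\ place u = p.
Proof.
elim: w p => [|c w IH] p /= [->|].
- by exists [::], [::]; rewrite /place big_nil.
- by [].
- by exists [::], (c :: w); rewrite /place big_nil.
- move=> /IH[u [v [-> Eu]]]; exists (c :: u), v.
  by rewrite place_cons Eu addrC subrK.
Qed.

Variable norm : V -> nat.
Hypothesis norm0 : norm 0 = 0%N.
Hypothesis normD : forall p q, (norm (p + q) <= norm p + norm q)%N.
Hypothesis normN : forall p, norm (- p) = norm p.
Hypothesis norm_phi : forall x, (norm (phi x) <= 1)%N.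

Lemma norm_place w : (norm (place w) <= size w)%N.
Proof.
elim: w => [|c w IH]; first by rewrite /place big_nil norm0.
rewrite place_cons; apply: leq_trans (normD _ _) _.
by rewrite /= -add1n leq_add //; case: c => x /=; rewrite ?normN.
Qed.

(** A walk through [p] and [q] reaches one of them first and then has to join
it to the other. *)
Lemma trace_size w p q : trace w p -> trace w q ->
  (minn (norm p) (norm q) + norm (q - p) <= size w)%N.
Proof.
move=> /trace_split[u [v [-> <-]]] /trace_cat[]/trace_split[u1 [u2 [-> E]]].
  rewrite -{}E place_cat opprD addrA subrr add0r normN !size_cat.
  move: (norm_place u1) (norm_place u2); lia.
rewrite -{}E !size_cat.
move: (norm_place u) (norm_place u1); lia.
Qed.

(** Any R-equivalent walk visits both [place w1] and [place (w1 ++ w2)].  These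
points are [size w2] apart, and the nearer of them to the origin is the first
one, at distance [size w1]. *)
Lemma Geo_cat w1 w2 :
  norm (place w1) = size w1 -> norm (place w2) = size w2 ->
  (size w1 <= norm (place (w1 ++ w2)))%N ->
  Geo (@greenR (FIM X)) (w1 ++ w2).
Proof.
move=> N1 N2 N12; split; first by exists (w1 ++ w2).
move=> _ [u uw <-].
have t1 : trace (w1 ++ w2) (place w1) by apply/trace_cat; left; apply: trace_place.
have := trace_size (greenR_trace uw t1) (greenR_trace uw (trace_place _)).
rewrite (minn_idPl _) ?N1 //.
by rewrite place_cat [place w1 + _]addrC addrK N2 size_cat.
Qed.

End Trace.

(** * Pumping the word a^(K+1) a'^(K+1) b'^K *)

Lemma subseq_cat_split (T : eqType) (s s1 s2 : seq T) : subseq s (s1 ++ s2) ->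
  exists t1 t2, [/\ s = t1 ++ t2, subseq t1 s1 & subseq t2 s2].
Proof.
case/subseqP=> k sz ->.
exists (mask (take (size s1) k) s1), (mask (drop (size s1) k) s2).
split; try exact: mask_subseq.
rewrite -mask_cat ?cat_take_drop // size_take_min sz size_cat.
by rewrite (minn_idPl _) ?leq_addr.
Qed.

Definition staircase (T : Type) (a a' b' : T) K : seq T :=
  nseq K.+1 a ++ nseq K.+1 a' ++ nseq K b'.

Section Staircase.
Variables (T : eqType) (a a' b' : T).
Hypotheses (aa' : a != a') (ab' : a != b') (a'b' : a' != b').

Local Notation staircase := (staircase a a' b').

Lemma nth_staircase K i : (i < size (staircase K)) ->
  nth a (staircase K) i =
    if (i < K.+1) then a else if (i < K.+1 + K.+1) then a' else b'.
Proof.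
rewrite /staircase !size_cat !size_nseq !nth_cat !size_nseq !nth_nseq => lti.
case: (ltnP i K.+1) => // Ki.
have -> : (i - K.+1 < K.+1) = (i < K.+1 + K.+1) by lia.
case: ltnP => // Ki2.
by have -> : (i - K.+1 - K.+1 < K) by lia.
Qed.

Lemma mem_staircase_factor K u v w c : staircase K = u ++ v ++ w -> c \in v ->
  exists2 i, (size u <= i < size u + size v) &
    c = if (i < K.+1) then a else if (i < K.+1 + K.+1) then a' else b'.
Proof.
move=> E cv; have iv : (index c v < size v) by rewrite index_mem.
exists (size u + index c v); first by lia.
rewrite -nth_staircase; last by rewrite E !size_cat; lia.
by rewrite E nth_cat ltnNge leq_addr /= addKn nth_cat iv nth_index.
Qed.

(** A factor meeting both outer blocks contains the whole middle block. *)
Lemma staircase_factor_size K u v w : staircase K = u ++ v ++ w ->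
  a \in v -> b' \in v -> (K < size v).
Proof.
move=> E /(mem_staircase_factor E)[i iv Ea] /(mem_staircase_factor E)[j jv Eb].
have iK : i < K.+1.
  by case: ltnP Ea => // _; case: ifP => _ /eqP; rewrite ?(negPf aa') ?(negPf ab').
have jK : K.+1 + K.+1 <= j.
  case: (ltnP j K.+1) Eb => [_ /eqP|_]; first by rewrite eq_sym (negPf ab').
  by case: ltnP => // _ /eqP; rewrite eq_sym (negPf a'b').
lia.
Qed.

(** The first letter of [q] stands at position [size p], and positions up to
[K] carry [a]. *)
Lemma staircase_cut K p q r : staircase K = p ++ q ++ r -> q != [::] ->
  a \notin q -> exists p', p = nseq K.+1 a ++ p' /\
    p' ++ q ++ r = nseq K.+1 a' ++ nseq K b'.
Proof.
case: q => // c q E _; rewrite inE negb_or => /andP[ca _].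
have [i] := mem_staircase_factor (v := [:: c]) E (mem_head _ _).
rewrite addn1 ltnS -eqn_leq => /eqP<-; case: ltnP => [_ Ec|Kp _].
  by rewrite Ec eqxx in ca.
have Ep : p = nseq K.+1 a ++ drop K.+1 p.
  rewrite -{1}[p](cat_take_drop K.+1); congr cat.
  move: (congr1 (take K.+1) E).
  by rewrite /staircase take_size_cat ?size_nseq // takel_cat // => <-.
exists (drop K.+1 p); split=> //.
apply/eqP; move/eqP: E; rewrite {1}Ep -catA /staircase eqseq_cat // => /andP[_].
by rewrite eq_sym.
Qed.

(** The block of [a] precedes both pumped factors, so it is left untouched and
everything inserted consists of [a'] and [b']. *)
Lemma staircase_pump_up K u v m t z : staircase K = u ++ v ++ m ++ t ++ z ->
  (0 < size (v ++ t)) -> a \notin v ++ t ->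
  exists w, [/\ u ++ wpow v 2 ++ m ++ wpow t 2 ++ z = nseq K.+1 a ++ w,
    all (mem [:: a'; b']) w, K < count_mem a' w & K.+1 + K.+1 <= size w].
Proof.
rewrite mem_cat negb_or => E vt /andP[av at_].
pose tail := nseq K.+1 a' ++ nseq K b'.
have tail_ab : all (mem [:: a'; b']) tail.
  by rewrite all_cat !all_nseq !inE !eqxx !orbT.
have tail_a' : count_mem a' tail = K.+1.
  by rewrite count_cat !count_nseq /= eqxx eq_sym (negPf a'b'); lia.
have tail_size : size tail = (K.+1 + K) by rewrite size_cat !size_nseq.
rewrite /wpow /= !cats0.
(* Where the first block ends is located with whichever factor is nonempty. *)
case: (eqVneq v [::]) => [v0|vn0]; last first.
  have [u' [-> Et]] := staircase_cut E vn0 av.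
  move: tail_ab tail_a' tail_size; rewrite /tail -Et -!catA.
  rewrite !all_cat !count_cat !size_cat => /and5P[u_ab v_ab m_ab t_ab z_ab] ca ct.
  have vgt : (0 < size v) by case: (v) vn0.
  exists (u' ++ v ++ v ++ m ++ t ++ t ++ z).
  split; rewrite -?catA // ?all_cat ?count_cat ?size_cat; [|lia|lia].
  by rewrite u_ab v_ab m_ab t_ab.
subst v; have tn0 : t != [::] by case: (t) vt.
have [p' [Ep Et]] : exists p', u ++ m = nseq K.+1 a ++ p' /\ p' ++ t ++ z = tail.
  by apply: staircase_cut tn0 at_; rewrite E -!catA.
rewrite /= catA Ep -!catA.
move: tail_ab tail_a' tail_size; rewrite -Et.
rewrite !all_cat !count_cat !size_cat => /and3P[p_ab t_ab z_ab] ca ct.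
have tgt : (0 < size t) by case: (t) tn0.
exists (p' ++ t ++ t ++ z).
split; rewrite -?catA // ?all_cat ?count_cat ?size_cat; [|lia|lia].
by rewrite p_ab t_ab.
Qed.

(** As [a] occurs in a pumped factor and the window is shorter than the middle
block, [b'] does not: at least one [a] is deleted and no [b'].  A subword
of the staircase still has all its [a] in front. *)
Lemma staircase_pump_down K u v m t z : staircase K = u ++ v ++ m ++ t ++ z ->
  (size (v ++ m ++ t) <= K) -> a \in v ++ t ->
  exists i w, [/\ u ++ m ++ z = nseq i a ++ w,
    all (mem [:: a'; b']) w, i <= K & count_mem b' w = K].
Proof.
move=> E szK avt.
have sub : subseq (u ++ m ++ z) (staircase K).
  rewrite E; apply: cat_subseq => //; apply: (@cat_subseq _ [::]) (sub0seq _) _.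
  by apply: cat_subseq => //; apply: suffix_subseq.
have b'vt : b' \notin v ++ t.
  apply/negP=> bvt; move: szK; apply/negP; rewrite -ltnNge.
  have E' : staircase K = u ++ (v ++ m ++ t) ++ z by rewrite E -!catA.
  have sub_vmt c : c \in v ++ t -> c \in v ++ m ++ t.
    by rewrite !mem_cat => /orP[]->; rewrite ?orbT.
  by apply: (staircase_factor_size E'); apply: sub_vmt.
have Ecount c : count_mem c (staircase K) =
    (count_mem c (u ++ m ++ z) + count_mem c (v ++ t)).
  by rewrite E !count_cat; lia.
have a_lt : (count_mem a (u ++ m ++ z) <= K).
  have := Ecount a.
  have : 0 < count_mem a (v ++ t) by rewrite -has_count has_pred1.
  rewrite /staircase !count_cat !count_nseq /= eqxx ![_ == a]eq_sym.
  by rewrite (negPf aa') (negPf ab'); lia.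
have b_eq : count_mem b' (u ++ m ++ z) = K.
  have := Ecount b'; rewrite (count_memPn b'vt).
  by rewrite /staircase !count_cat !count_nseq /= eqxx (negPf ab') (negPf a'b'); lia.
have [s1 [s2 [Es sub1 sub2]]] := subseq_cat_split sub.
have s2_ab : all (mem [:: a'; b']) s2.
  apply/allP=> c /(mem_subseq sub2); rewrite mem_cat !mem_nseq !inE /=.
  by case/orP=> [->|/andP[_ ->]] //; rewrite orbT.
have s1_a : s1 = nseq (size s1) a.
  apply/all_pred1P/allP=> c /(mem_subseq sub1).
  by rewrite mem_nseq => /andP[].
have s2_a : count_mem a s2 = 0.
  apply/count_memPn/negP => /(allP s2_ab).
  by rewrite !inE (negPf aa') (negPf ab').
have s1_b : count_mem b' s1 = 0 by rewrite s1_a count_nseq /= (negPf ab').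
exists (size s1), s2; split=> //; first by rewrite Es {1}s1_a.
  by move: a_lt; rewrite Es count_cat s2_a s1_a count_nseq /= eqxx size_nseq; lia.
by move: b_eq; rewrite Es count_cat s1_b.
Qed.

End Staircase.

(** * Geodesic words and the main result *)

Section GeoStaircase.
Local Open Scope ring_scope.
Variables (X : finType) (x y : X).
Hypothesis xy : x != y.

Local Notation a := (inl x : letter X).
Local Notation a' := (inr x : letter X).
Local Notation b := (inl y : letter X).
Local Notation b' := (inr y : letter X).

Definition coord (z : X) : int * int := ((z == x)%:Z, (z == y)%:Z).
Definition l1_norm (p : int * int) : nat := (`|p.1| + `|p.2|)%N.

Lemma l1_norm_coord z : (l1_norm (coord z) <= 1)%N.
Proof.
rewrite /l1_norm /coord /=.
by have [->|_] := eqVneq z x; [rewrite (negPf xy) | case: (z == y)].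
Qed.

Lemma place_pos i : place coord (nseq i a) = (i%:Z, 0).
Proof.
elim: i => [|i IH]; first by rewrite /place big_nil.
rewrite /= place_cons IH /= /coord eqxx (negPf xy).
by congr pair; rewrite /=; lia.
Qed.

Lemma place_neg w : all (mem [:: a'; b']) w ->
  place coord w = (- (count_mem a' w)%:Z, - (count_mem b' w)%:Z).
Proof.
elim: w => [|c w IH] /=; first by rewrite /place big_nil.
rewrite !inE => /andP[cab /IH {}IH].
rewrite place_cons {}IH; case/orP: cab => /eqP-> /=; rewrite /coord !eqxx.
  rewrite (negPf xy) (_ : (a' == b') = false); last by apply/negbTE.
  by congr pair; rewrite /=; lia.
rewrite (eq_sym y) (negPf xy) (_ : (b' == a') = false).
  by congr pair; rewrite /=; lia.
by apply/negbTE; rewrite eq_sym.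
Qed.

Lemma size_neg w : all (mem [:: a'; b']) w ->
  size w = (count_mem a' w + count_mem b' w)%N.
Proof.
elim: w => //= c w IH; rewrite !inE => /andP[cab /IH ->].
have ab : (a' == b') = false by apply/negbTE.
by case/orP: cab => /eqP->; rewrite !eqxx ?ab ?[b' == _]eq_sym ?ab; lia.
Qed.

(** Both legs of the walk are monotone in each coordinate, hence geodesic for
the l1 metric, and the inequality says that the end point is at least as
far from the origin as the turning point. *)
Lemma Geo_pos_neg i w : all (mem [:: a'; b']) w ->
  (i <= `|i%:Z - (count_mem a' w)%:Z| + count_mem b' w)%N ->
  Geo (@greenR (FIM X)) (nseq i a ++ w).
Proof.
move=> wab; move: (place_neg wab) (size_neg wab).
move: (count_mem a' w) (count_mem b' w) => k l Ep Es le_i.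
apply: (@Geo_cat X _ coord l1_norm).
- by [].
- by move=> p q; rewrite /l1_norm /=; lia.
- by move=> p; rewrite /l1_norm /=; lia.
- exact: l1_norm_coord.
- by rewrite place_pos /l1_norm /= size_nseq; lia.
- by rewrite Ep /l1_norm /= Es; lia.
- by rewrite place_cat place_pos Ep /l1_norm /= size_nseq; lia.
Qed.

(** The idempotents f f^-1 and e e^-1 commute: exploring the branch of
f = b'^K first and ending at the tip of e = a^(K+1) covers the same tree
with one letter less. *)
Lemma staircase_not_Geo K : ~ Geo (@greenR (FIM X)) (staircase a a' b' K).
Proof.
case=> _ min_w.
pose e := nseq K.+1 a; pose f := nseq K b'.
have Ee : word_inv e = nseq K.+1 a' by rewrite /word_inv map_nseq rev_nseq.
have Ew : staircase a a' b' K = e ++ word_inv e ++ f by rewrite Ee.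
suff R : greenR (FIM_pi (f ++ word_inv f ++ e)) (FIM_pi (staircase a a' b' K)).
  have := min_w (size (f ++ word_inv f ++ e)).
  rewrite /staircase !size_cat size_word_inv !size_nseq => H.
  suff: (K.+1 + (K.+1 + K) <= K + (K + K.+1))%N by lia.
  apply: H; exists (f ++ word_inv f ++ e) => //.
  by rewrite !size_cat size_word_inv !size_nseq.
apply/greenR_vagner; rewrite Ew; split.
  exists (word_inv e ++ f).
  apply: vagner_trans (_ : vagner (e ++ word_inv e ++ f ++ word_inv f ++ f) _).
    have := vagner_cat (vagner_comm f e) (vagner_refl f); by rewrite -!catA.
  have := vagner_cat (vagner_refl (e ++ word_inv e)) (vagner_reg f).
  by rewrite -!catA.
exists (word_inv f ++ e).
apply: vagner_trans (_ : vagner (f ++ word_inv f ++ e ++ word_inv e ++ e) _).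
  have := vagner_cat (vagner_comm e f) (vagner_refl e); by rewrite -!catA.
have := vagner_cat (vagner_refl (f ++ word_inv f)) (vagner_reg e).
by rewrite -!catA.
Qed.

(** Whichever way the staircase is pumped, some pumped word is R-geodesic. *)
Lemma compl_Geo_greenR_not_pumpable :
  ~ pumpable (~` Geo (@greenR (FIM X)))%classic.
Proof.
have [aa' ab' a'b'] : [/\ a != a', a != b' & a' != b'] by [].
case=> K /(_ (staircase a a' b' K) (@staircase_not_Geo K)).
case=> [|u [v [m [t [z [E vt szK H]]]]]].
  by rewrite !size_cat !size_nseq; lia.
have [avt|avt] := boolP (a \in v ++ t).
  have [i [w [Ew w_ab iK bK]]] := staircase_pump_down aa' ab' a'b' E szK avt.
  by apply: (H 0%N); rewrite Ew; apply: Geo_pos_neg => //; rewrite bK; lia.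
have [w [Ew w_ab]] := staircase_pump_up aa' ab' a'b' E vt avt.
rewrite (size_neg w_ab) => aK szw; apply: (H 2%N); rewrite Ew.
apply: Geo_pos_neg => //.
by move: aK szw; move: (count_mem a' w) (count_mem b' w) => k l; lia.
Qed.

End GeoStaircase.

Theorem proposition8p2 (X : finType) (hX : 2 <= #|X|) :
  ~ co_context_free (Geo (@greenR (FIM X))) /\
  ~ co_context_free (Geo (@greenL (FIM X))).
Proof.
have [x [y [_ _ xy]]] := card_gt1P hX.
have notR := compl_Geo_greenR_not_pumpable xy.
split=> /context_free_pumpable // /pumpable_word_inv pumpL.
apply: notR; move: pumpL; congr pumpable.
apply/seteqP; split=> w /= notG G; apply: notG.
  by apply/Geo_greenL; rewrite word_invK.
by have := (Geo_greenL _).1 G; rewrite word_invK.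
Qed.
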